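(* Let $\mathcal{A}\in\mathbb{R}^{[l,n]}$ be a strong $\mathcal{M}$-tensor, let $\mathbf{b}\in\mathbb{R}^n_{++}$, and let $\mathcal{A}=\mathcal{E}-\mathcal{F}$ be a regular or weak regular splitting. Let $\mathbf{z}_0\in\mathbb{R}^n_{++}$ be any initial vector with $0<\mathcal{A}\mathbf{z}_0^{l-1}\le\mathbf{b}$, and let $(\mathbf{z}_k)_{k\ge 1}$ be generated from $\mathbf{z}_0$ by the RTSMRAA algorithm (described in the context). If $\theta_k\in[0,1)$ for all $k\ge 1$, then $\mathbf{z}_k\in\mathbb{R}^n_{++}$ for all $k\ge 1$.
   Context: Conventions. $\mathbb{R}^{[l,n]}$ is the set of real tensors $\mathcal{A}=(a_{i_1\cdots i_l})$ of order $l$ and dimension $n$ (indices in $\{1,\dots,n\}$), $l\ge 2$. $\mathbb{R}^n_+$ and $\mathbb{R}^n_{++}$ are the sets of entrywise nonnegative and entrywise positive vectors; inequalities between vectors, matrices, tensors are entrywise; $\|\cdot\|$ is the 2-norm. For $\mathbf{x}\in\mathbb{R}^n$, $\mathcal{A}\mathbf{x}^{l-1}\in\mathbb{R}^n$ has entries $(\mathcal{A}\mathbf{x}^{l-1})_i=\sum_{i_2,\dots,i_l=1}^n a_{ii_2\cdots i_l}x_{i_2}\cdots x_{i_l}$. For a vector $\mathbf{y}$ and exponent $p$, $\mathbf{y}^{[p]}$ is the vector with entries $y_i^p$. $\mathcal{I}_l$ is the unit tensor (entries $1$ if $i_1=\cdots=i_l$ and $0$ otherwise). For an $n\times n$ matrix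 $A=(a_{ij})$ and $\mathcal{B}\in\mathbb{R}^{[k,n]}$, the product $A\mathcal{B}\in\mathbb{R}^{[k,n]}$ has entries $(A\mathcal{B})_{ji_2\cdots i_k}=\sum_{j_2=1}^n a_{jj_2}b_{j_2i_2\cdots i_k}$. Eigenvalues: $\lambda\in\mathbb{C}$ is an eigenvalue of $\mathcal{A}$ if $\mathcal{A}\mathbf{x}^{l-1}=\lambda\mathbf{x}^{[l-1]}$ for some nonzero $\mathbf{x}\in\mathbb{C}^n$; $\rho(\mathcal{A})$ is the largest modulus of an eigenvalue. $\mathcal{A}$ is a strong $\mathcal{M}$-tensor if $\mathcal{A}=\eta\mathcal{I}_l-\mathcal{B}$ for some tensor $\mathcal{B}\ge 0$ and some real $\eta>\rho(\mathcal{B})$, $\eta>0$. The majorization matrix $M(\mathcal{A})$ is the $n\times n$ matrix with $M(\mathcal{A})_{ij}=a_{ij\cdots j}$. $\mathcal{E}$ is left-nonsingular if $\mathcal{E}=M(\mathcal{E})\mathcal{I}_l$ and $M(\mathcal{E})$ is nonsingular. $\mathcal{A}=\mathcal{E}-\mathcal{F}$ is a regular splitting if $\mathcal{E}$ is left-nonsingular, $M(\mathcal{E})^{-1}\ge 0$ and $\mathcal{F}\ge 0$; it is a weak regular splitting if $\mathcal{E}$ is left-nonsingular, $M(\mathcal{E})^{-1}\ge 0$ and $M(\mathcal{E})^{-1}\mathcal{F}\ge 0$. Define $g_{\mathcal{E}}(\mathbf{x})=\big(M(\mathcal{E})^{-1}\mathcal{F}\mathbf{x}^{l-1}+M(\mathcal{E})^{-1}\mathbf{b}\big)^{[\frac{1}{l-1}]}$.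 RTSMRAA algorithm (restarted tensor splitting method with relaxed Anderson acceleration). Fixed parameters: an integer $m\ge 1$, a constant $\kappa_{\boldsymbol{\alpha}}>0$, relaxation parameters $\theta_k\in[0,1]$. Given a positive initial vector $\mathbf{z}_0$, set $\mathbf{z}_1=g_{\mathcal{E}}(\mathbf{z}_0)$, $\boldsymbol{\mu}_1=\mathbf{y}_1=\mathbf{z}_1$, $f_0=\mathbf{z}_1-\mathbf{z}_0$. For $k=1,2,\dots$: set $m_k=\min\{m,k\}$; compute $\boldsymbol{\mu}_{k+1}=g_{\mathcal{E}}(\mathbf{z}_k)$ and $f_k=\boldsymbol{\mu}_{k+1}-\mathbf{z}_k$; let $\boldsymbol{\alpha}^{(k)}=(\alpha^{(k)}_0,\dots,\alpha^{(k)}_{m_k})^T$ be a minimizer of $\big\|\sum_{i=0}^{m_k}\alpha_i f_{k-m_k+i}\big\|$ over real $\alpha$ subject to $\sum_{i=0}^{m_k}\alpha_i=1$; set $\mathbf{y}_{k+1}=\sum_{i=0}^{m_k}\alpha_i^{(k)}g_{\mathcal{E}}(\mathbf{z}_{k-m_k+i})$. If $\mathbf{y}_{k+1}\ge 0$ and $\sum_{i=0}^{m_k}|\alpha_i^{(k)}|\le\kappa_{\boldsymbol{\alpha}}$, then set $\mathbf{z}_{k+1}=\theta_k\mathbf{y}_{k+1}+(1-\theta_k)\boldsymbol{\mu}_{k+1}$; otherwise set $\mathbf{z}_{k+1}=\boldsymbol{\mu}_{k+1}$. *)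

(* Defs.v *)
From HB Require Import structures.
From mathcomp Require Import all_boot all_order all_algebra.
From mathcomp Require Import complex.
From mathcomp Require Import all_classical all_reals all_analysis.

Set Implicit Arguments.
Unset Strict Implicit.
Unset Printing Implicit Defensive.

Import Order.TTheory GRing.Theory Num.Theory.
Local Open Scope classical_set_scope.
Local Open Scope ring_scope.

(* The entry a_{i1 i2 ... il} of A is A (i1, [tuple i2; ...; il]): the first
   index is kept apart because it plays a special role in A x^{l-1}, M(A) and
   the matrix-tensor product.  Only meaningful for 1 <= l. *)
Notation tensor K l n := {ffun 'I_n * l.-1.-tuple 'I_n -> K}.

Section Order.
Variable R : numDomainType.

Definition mx_le p q (A B : 'M[R]_(p, q)) : bool :=
  [forall i, forall j, A i j <= B i j].

Definition mx_lt p q (A B : 'M[R]_(p, q)) : bool :=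
  [forall i, forall j, A i j < B i j].

Definition tensor_le l n (A B : tensor R l n) : bool :=
  [forall t, A t <= B t].

End Order.

Section TensorAlgebra.
Variable K : comNzRingType.

(* A x^{l-1} *)
Definition tensor_app l n (A : tensor K l n) (x : 'cV[K]_n) : 'cV[K]_n :=
  \col_i \sum_(t : l.-1.-tuple 'I_n) A (i, t) * \prod_(j <- t) x j 0.

Definition unit_tensor l n : tensor K l n :=
  [ffun t : 'I_n * l.-1.-tuple 'I_n => (all (pred1 t.1) t.2)%:R].

Definition mul_mx_tensor l n (A : 'M[K]_n) (B : tensor K l n) : tensor K l n :=
  [ffun t => \sum_(j < n) A t.1 j * B (j, t.2)].

Definition majorization_mx l n (A : tensor K l n) : 'M[K]_n :=
  \matrix_(i, j) A (i, [tuple of nseq l.-1 j]).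

End TensorAlgebra.

Section RealTensors.
Variable R : realType.

Definition tensor_eigenvalue l n (A : tensor R l n) (lambda : R[i]) : Prop :=
  exists2 x : 'cV[R[i]]_n, x != 0 &
    tensor_app ([ffun t => (A t)%:C%C] : tensor R[i] l n) x =
    lambda *: \col_i (x i 0 ^+ l.-1).

(* For 2 <= l and 1 <= n there are eigenvalues, and finitely many of them, so
   this supremum is the largest modulus. *)
Definition spectral_radius l n (A : tensor R l n) : R :=
  sup [set Normc.normc lambda | lambda in [set mu | tensor_eigenvalue A mu]].

Definition strong_M_tensor l n (A : tensor R l n) : Prop :=
  exists (B : tensor R l n) (eta : R),
    [/\ A = eta *: unit_tensor R l n - B, tensor_le 0 B,
        spectral_radius B < eta & 0 < eta].

Definition left_nonsingular l n (E : tensor R l n) : Prop :=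
  E = mul_mx_tensor (majorization_mx E) (unit_tensor R l n) /\
  majorization_mx E \in unitmx.

Definition regular_splitting l n (A E F : tensor R l n) : Prop :=
  [/\ A = E - F, left_nonsingular E,
      mx_le 0 (invmx (majorization_mx E)) & tensor_le 0 F].

Definition weak_regular_splitting l n (A E F : tensor R l n) : Prop :=
  [/\ A = E - F, left_nonsingular E,
      mx_le 0 (invmx (majorization_mx E)) &
      tensor_le 0 (mul_mx_tensor (invmx (majorization_mx E)) F)].

(* powR takes the meaningless value 1 at a negative base; in the algorithm below
   with z_0 > 0, b > 0 and a (weak) regular splitting, only nonnegative bases
   occur. *)
Definition vec_powR n (y : 'cV[R]_n) (p : R) : 'cV[R]_n :=
  \col_i (y i 0 `^ p).

Definition splitting_map l n (E F : tensor R l n) (b x : 'cV[R]_n) : 'cV[R]_n :=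
  vec_powR
    (tensor_app (mul_mx_tensor (invmx (majorization_mx E)) F) x
     + invmx (majorization_mx E) *m b)
    (l.-1%:R^-1).

(* The norm that the library puts on 'cV[R]_n is the max norm. *)
Definition norm2 n (v : 'cV[R]_n) : R := Num.sqrt (\sum_i v i 0 ^+ 2).

Definition anderson_minimizer p n (u : 'I_p -> 'cV[R]_n) (a : 'cV[R]_p) : Prop :=
  \sum_i a i 0 = 1 /\
  forall c : 'cV[R]_p, \sum_i c i 0 = 1 ->
    norm2 (\sum_i a i 0 *: u i) <= norm2 (\sum_i c i 0 *: u i).

(* The minimizer alpha k need not be unique, so the algorithm is a relation
   satisfied by every sequence of iterates it may produce. *)
Record RTSMRAA l n (E F : tensor R l n) (b : 'cV[R]_n)
    (m : nat) (kappa : R) (theta : nat -> R) (z0 : 'cV[R]_n)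
    (z mu y f : nat -> 'cV[R]_n)
    (alpha : forall k : nat, 'cV[R]_(minn m k).+1) : Prop := {
  RTSMRAA_z0 : z 0%N = z0;
  RTSMRAA_z1 : z 1%N = splitting_map E F b (z 0%N);
  RTSMRAA_mu1 : mu 1%N = z 1%N;
  RTSMRAA_y1 : y 1%N = z 1%N;
  RTSMRAA_f0 : f 0%N = z 1%N - z 0%N;
  RTSMRAA_mu : forall k, (1 <= k)%N ->
    mu k.+1 = splitting_map E F b (z k);
  RTSMRAA_f : forall k, (1 <= k)%N -> f k = mu k.+1 - z k;
  RTSMRAA_alpha : forall k, (1 <= k)%N ->
    anderson_minimizer (fun i => f (k - minn m k + i)%N) (alpha k);
  RTSMRAA_y : forall k, (1 <= k)%N ->
    y k.+1 = \sum_(i < (minn m k).+1)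
      alpha k i 0 *: splitting_map E F b (z (k - minn m k + i)%N);
  RTSMRAA_z : forall k, (1 <= k)%N ->
    z k.+1 =
      if mx_le 0 (y k.+1) && (\sum_i `|alpha k i 0| <= kappa)
      then theta k *: y k.+1 + (1 - theta k) *: mu k.+1
      else mu k.+1
}.

End RealTensors.

Arguments RTSMRAA {R l n} E F b m kappa theta z0 z mu y f alpha.

(* Main.v *)
Require Import Defs.
From HB Require Import structures.
From mathcomp Require Import all_boot all_order all_algebra.
From mathcomp Require Import all_classical all_reals all_analysis.

Set Implicit Arguments.
Unset Strict Implicit.
Unset Printing Implicit Defensive.

Import Order.TTheory GRing.Theory Num.Theory.
Local Open Scope ring_scope.

(** The splitting map sends every entrywise nonnegative vector to an entrywise
    positive one.  Under either kind of splitting the tensor M(E)^-1 F is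
    nonnegative, so the term M(E)^-1 F x^{l-1} is nonnegative.  The term
    M(E)^-1 b is positive, because a nonnegative invertible matrix has no zero
    row and b is positive.  A power of a positive number is positive, whatever
    the exponent ([splitting_map_gt0]).

    Positivity of the iterates follows by induction.  The candidate mu_{k+1} is
    positive as the image of z_k, and z_{k+1} is either mu_{k+1} or a convex
    combination of mu_{k+1} with a vector y_{k+1} that the safeguard makes
    nonnegative; since theta_k < 1, the weight of mu_{k+1} is positive
    ([convex_combination_gt0]). *)

Lemma mx_le0P (R : numDomainType) (p q : nat) (A : 'M[R]_(p, q)) :
  reflect (forall i j, 0 <= A i j) (mx_le 0 A).
Proof.
apply: (iffP forallP) => [h i j|h i].
  by move/forallP: (h i) => /(_ j); rewrite mxE.
by apply/forallP => j; rewrite mxE.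
Qed.

Lemma mx_lt0P (R : numDomainType) (p q : nat) (A : 'M[R]_(p, q)) :
  reflect (forall i j, 0 < A i j) (mx_lt 0 A).
Proof.
apply: (iffP forallP) => [h i j|h i].
  by move/forallP: (h i) => /(_ j); rewrite mxE.
by apply/forallP => j; rewrite mxE.
Qed.

Lemma tensor_le0P (R : realType) (l n : nat) (A : tensor R l n) :
  reflect (forall t, 0 <= A t) (tensor_le 0 A).
Proof. by apply: (iffP forallP) => h t; move: (h t); rewrite ffunE. Qed.

Lemma mx_ltW0 (R : numDomainType) (p q : nat) (A : 'M[R]_(p, q)) :
  mx_lt 0 A -> mx_le 0 A.
Proof. by move=> /mx_lt0P h; apply/mx_le0P => i j; exact: ltW. Qed.

Lemma mul_mx_tensor_ge0 (R : realType) (l n : nat) (A : 'M[R]_n)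
    (B : tensor R l n) :
  mx_le 0 A -> tensor_le 0 B -> tensor_le 0 (mul_mx_tensor A B).
Proof.
move=> /mx_le0P hA /tensor_le0P hB; apply/tensor_le0P => t.
by rewrite ffunE; apply: sumr_ge0 => j _; rewrite mulr_ge0.
Qed.

Lemma tensor_app_ge0 (R : realType) (l n : nat) (A : tensor R l n)
    (x : 'cV[R]_n) :
  tensor_le 0 A -> mx_le 0 x -> mx_le 0 (tensor_app A x).
Proof.
move=> /tensor_le0P hA /mx_le0P hx; apply/mx_le0P => i j.
rewrite mxE; apply: sumr_ge0 => t _.
by rewrite mulr_ge0 // prodr_ge0.
Qed.

(** If an entry of the product vanished, then so would every term of the sum of
    nonnegative terms defining it, hence a whole row of the matrix; this is
    impossible for an invertible matrix. *)
Lemma unitmx_mul_gt0 (R : realType) (n : nat) (M : 'M[R]_n) (b : 'cV[R]_n) :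
  M \in unitmx -> mx_le 0 M -> mx_lt 0 b -> mx_lt 0 (M *m b).
Proof.
move=> uM /mx_le0P hM /mx_lt0P hb; apply/mx_lt0P => i j.
have terms_ge0 k : true -> 0 <= M i k * b k j.
  by move=> _; rewrite mulr_ge0 // ltW.
rewrite mxE lt_def sumr_ge0 // andbT; apply/negP.
rewrite psumr_eq0 // => /allP terms0.
have row0 k : M i k = 0.
  have := terms0 k (mem_index_enum k).
  by rewrite /= mulf_eq0 (gt_eqF (hb k j)) orbF => /eqP.
have : (M *m invmx M) i i = 0.
  by rewrite mxE big1 // => k _; rewrite row0 mul0r.
by rewrite mulmxV // mxE eqxx => /eqP; rewrite oner_eq0.
Qed.

(** M(E)^-1 F is a product of nonnegative factors. *)
Lemma regular_splitting_weak (R : realType) (l n : nat) (A E F : tensor R l n) :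
  regular_splitting A E F -> weak_regular_splitting A E F.
Proof. by case=> hA hE hM hF; split=> //; exact: mul_mx_tensor_ge0. Qed.

Lemma splitting_map_gt0 (R : realType) (l n : nat) (A E F : tensor R l n)
    (b x : 'cV[R]_n) :
  weak_regular_splitting A E F -> mx_lt 0 b -> mx_le 0 x ->
  mx_lt 0 (splitting_map E F b x).
Proof.
case=> _ [_ uE] hM hMF hb hx.
have /mx_le0P hFx := tensor_app_ge0 hMF hx.
have uM : invmx (majorization_mx E) \in unitmx by rewrite unitmx_inv.
have /mx_lt0P hMb := unitmx_mul_gt0 uM hM hb.
apply/mx_lt0P => i j; rewrite mxE powR_gt0 // mxE.
exact: ltr_wpDl.
Qed.

Lemma convex_combination_gt0 (R : realType) (p q : nat) (t : R)
    (A B : 'M[R]_(p, q)) :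
  0 <= t < 1 -> mx_le 0 A -> mx_lt 0 B -> mx_lt 0 (t *: A + (1 - t) *: B).
Proof.
case/andP=> t0 t1 /mx_le0P hA /mx_lt0P hB; apply/mx_lt0P => i j.
by rewrite !mxE ltr_wpDl ?mulr_ge0 // mulr_gt0 // subr_gt0.
Qed.

Theorem proposition4p2 (R : realType) (l n : nat) (hl : (2 <= l)%N)
    (A E F : tensor R l n) (b : 'cV[R]_n)
    (hA : strong_M_tensor A) (hb : mx_lt 0 b)
    (hsplit : regular_splitting A E F \/ weak_regular_splitting A E F)
    (m : nat) (hm : (1 <= m)%N) (kappa : R) (hkappa : 0 < kappa)
    (theta : nat -> R) (htheta : forall k, (1 <= k)%N -> 0 <= theta k < 1)
    (z0 : 'cV[R]_n) (hz0 : mx_lt 0 z0)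
    (hAz0 : mx_lt 0 (tensor_app A z0)) (hAz0b : mx_le (tensor_app A z0) b)
    (z mu y f : nat -> 'cV[R]_n)
    (alpha : forall k : nat, 'cV[R]_(minn m k).+1)
    (hrun : RTSMRAA E F b m kappa theta z0 z mu y f alpha) :
  forall k, (1 <= k)%N -> mx_lt 0 (z k).
Proof.
have hweak : weak_regular_splitting A E F.
  by case: hsplit => // /regular_splitting_weak.
have map_gt0 x : mx_lt 0 x -> mx_lt 0 (splitting_map E F b x).
  by move=> /mx_ltW0; exact: splitting_map_gt0 hweak hb.
case=> [//|k _]; elim: k => [|k IHk].
  by rewrite (RTSMRAA_z1 hrun) (RTSMRAA_z0 hrun) map_gt0.
have mu_gt0 : mx_lt 0 (mu k.+2) by rewrite (RTSMRAA_mu hrun) // map_gt0.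
rewrite (RTSMRAA_z hrun) //; case: ifP => // /andP[y_ge0 _].
by apply: convex_combination_gt0 => //; exact: htheta.
Qed.
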